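(* Let $\mathcal C$ be an updown category with object generating function $O_{\mathcal C}(t)=\sum_{n\ge 0}a_nt^n$ and morphism generating function $M_{\mathcal C}(t)$. 1. If $\mathcal C$ is evenly up-covered with sequence $u_0,u_1,\dots$, then $M_{\mathcal C}(t)=\sum_{n\ge 0}a_nu_nt^{2n+1}$. 2. If $\mathcal C$ is evenly down-covered with sequence $d_1,d_2,\dots$, then $M_{\mathcal C}(t)=\sum_{n\ge 1}a_nd_nt^{2n-1}$.
   Context: An updown category is a small category $\mathcal C$ with a rank functor $|\cdot|:\mathcal C\to\mathbb N$ (where $\mathbb N=\{0,1,2,\dots\}$ is the ordered set of natural numbers regarded as a category) such that: (A1) each rank $\mathcal C_n=\{p\in\operatorname{Ob}\mathcal C:|p|=n\}$ is finite; (A2) $\mathcal C_0$ consists of a single object $\hat 0$, and $\operatorname{Hom}(\hat 0,p)$ is nonempty for all objects $p$; (A3) for objects $p,p'$, $\operatorname{Hom}(p,p')$ is always finite, and $\operatorname{Hom}(p,p')=\emptyset$ unless $|p|<|p'|$ or $p=p'$; in the latter case $\operatorname{Hom}(p,p)$ is a group, denoted $\operatorname{Aut}(p)$; (A4) any morphism $p\to p'$ with $|p'|=|p|+k$ factors as a composition $p=p_0\to p_1\to\cdots\to p_k=p'$ with $|p_{i+1}|=|p_i|+1$; (A5) if $|p'|=|p|+1$, the actions of $\operatorname{Aut}(p)$ and $\operatorname{Aut}(p')$ on $\operatorname{Hom}(p,p')$ (by precomposition and postcomposition respectively) are free. For objects $p,p'$ with $|p'|=|p|+1$, set $u(p;p')=|\operatorname{Hom}(p,p')|/|\operatorname{Aut}(p')|$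 and $d(p;p')=|\operatorname{Hom}(p,p')|/|\operatorname{Aut}(p)|$. Write $p\lhd q$ (equivalently $q\rhd p$) if $q$ covers $p$ in the partial order on $\operatorname{Ob}\mathcal C$ given by $p\preceq q\iff\operatorname{Hom}(p,q)\ne\emptyset$; equivalently, $|q|=|p|+1$ and $\operatorname{Hom}(p,q)\neq\emptyset$. $\mathcal C$ is evenly up-covered (with sequence $u_0,u_1,\dots$) if $\sum_{q\rhd p}u(p;q)=u_n$ for all $n$ and all $p\in\mathcal C_n$. $\mathcal C$ is evenly down-covered (with sequence $d_1,d_2,\dots$) if $\sum_{q\lhd p}d(q;p)=d_n$ for all $n\ge1$ and all $p\in\mathcal C_n$. The generating functions, elements of $\mathbb Q[[t]]$, are $$O_{\mathcal C}(t)=\sum_{p\in\operatorname{Ob}\mathcal C}\frac{t^{|p|}}{|\operatorname{Aut}(p)|},\qquad M_{\mathcal C}(t)=\sum_{p\lhd q}\frac{u(p;q)\,t^{|p|+|q|}}{|\operatorname{Aut}(p)|}.$$ *)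

(* Defs.v *)
From mathcomp Require Import all_boot all_order all_algebra.
From mathcomp Require Import boolp classical_sets functions cardinality fsbigop.
Set Implicit Arguments. Unset Strict Implicit. Unset Printing Implicit Defensive.
Import GRing.Theory.
Local Open Scope classical_set_scope.

(* The choiceType structure on objects is no restriction, since classically
   every type has one; it is only there to index sums.  Finiteness of the Hom
   sets, an axiom of updown categories, is the finType structure. *)
Record homFinCategory := HomFinCategory {
  ob :> choiceType ;
  hom : ob -> ob -> finType ;
  idm : forall p : ob, hom p p ;
  comp : forall p q r : ob, hom q r -> hom p q -> hom p r ;
  comp_idl : forall (p q : ob) (f : hom p q), comp (idm q) f = f ;
  comp_idr : forall (p q : ob) (f : hom p q), comp f (idm p) = f ;
  comp_assoc : forall (p q r s : ob) (h : hom r s) (g : hom q r) (f : hom p q),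
    comp h (comp g f) = comp (comp h g) f
}.
Arguments hom {h0} : rename.
Arguments idm {h0} : rename.
Arguments comp {h0 p q r} : rename.

(* [unit_chain rank k f]: f is a composition p_0 -> p_1 -> ... -> p_k of k >= 1
   morphisms, each of which raises the rank by exactly one. *)
Inductive unit_chain (C : homFinCategory) (rank : C -> nat) :
    nat -> forall p q : C, hom p q -> Prop :=
| unit_chain1 (p q : C) (f : hom p q) :
    rank q = (rank p).+1 -> unit_chain rank 1 f
| unit_chainS (k : nat) (p q r : C) (f : hom p q) (g : hom q r) :
    rank q = (rank p).+1 -> unit_chain rank k g ->
    unit_chain rank k.+1 (comp g f).

(* A functor to the poset nat is a function that is monotone along morphisms
   (rank_functor).  In unit_factor the case k = 0 is excluded: there p = q by
   hom_ranks, and reading the empty composition as the identity would force all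
   automorphism groups to be trivial. *)
Record updownCategory := UpdownCategory {
  ucat :> homFinCategory ;
  rank : ucat -> nat ;
  rank_functor : forall p q : ucat, hom p q -> (rank p <= rank q)%N ;
  rank_finite : forall n : nat, finite_set [set p : ucat | rank p = n] ;
  zero_ob : ucat ;
  rank0P : forall p : ucat, rank p = 0%N <-> p = zero_ob ;
  zero_hom : forall p : ucat, inhabited (hom zero_ob p) ;
  hom_ranks : forall p q : ucat, hom p q -> (rank p < rank q)%N \/ p = q ;
  endo_inv : forall (p : ucat) (f : hom p p),
    exists g : hom p p, comp g f = idm p /\ comp f g = idm p ;
  unit_factor : forall (p q : ucat) (k : nat) (f : hom p q),
    (0 < k)%N -> rank q = (rank p + k)%N -> unit_chain rank k f ;
  aut_source_free : forall (p q : ucat) (f : hom p q) (a : hom p p),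
    rank q = (rank p).+1 -> comp f a = f -> a = idm p ;
  aut_target_free : forall (p q : ucat) (f : hom p q) (b : hom q q),
    rank q = (rank p).+1 -> comp b f = f -> b = idm q
}.
Arguments rank {u} : rename.

(* Every endomorphism is invertible (endo_inv), so Aut(p) = Hom(p, p). *)
Definition aut (C : updownCategory) (p : C) : finType := hom p p.

Definition prec (C : updownCategory) (p q : C) : Prop := inhabited (hom p q).

Definition covers (C : updownCategory) (p q : C) : Prop :=
  [/\ prec p q, p <> q &
      forall r : C, prec p r -> prec r q -> r = p \/ r = q].

Lemma coversP (C : updownCategory) (p q : C) :
  covers p q <-> rank q = (rank p).+1 /\ prec p q.
Proof.
split=> [[[f] npq btw]|[rq pq]].
  have [ltpq|//] := hom_ranks f.
  split; last exact: inhabits.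
  have k0 : (0 < rank q - rank p)%N by rewrite subn_gt0.
  have rk : rank q = (rank p + (rank q - rank p))%N by rewrite subnKC // ltnW.
  case: (unit_factor f k0 rk) npq btw => // k p' r s g h rr _ npq btw.
  case: (btw r (inhabits g) (inhabits h)) => [rp|<-//].
  by move: rr; rewrite rp => /eqP; rewrite -[X in X == _]addn0 -addn1 eqn_add2l.
split=> // [epq|r [f] [g]].
  by move: rq; rewrite epq => /eqP; rewrite -[X in X == _]addn0 -addn1 eqn_add2l.
have [ltpr|->] := hom_ranks f; last by left.
have [ltrq|->] := hom_ranks g; last by right.
by move: (leq_ltn_trans ltpr ltrq); rewrite rq ltnn.
Qed.

Local Open Scope ring_scope.

Definition umult (C : updownCategory) (p q : C) : rat :=
  #|hom p q|%:R / #|aut q|%:R.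

Definition dmult (C : updownCategory) (p q : C) : rat :=
  #|hom p q|%:R / #|aut p|%:R.

(* Finitely supported sums default to 0 on infinite supports; the next two
   lemmas show that this never happens for the sums defining even coverings. *)
Lemma finite_covers_up (C : updownCategory) (p : C) :
  finite_set [set q : C | covers p q].
Proof.
apply: sub_finite_set (rank_finite C (rank p).+1) => q /= /coversP[]; by [].
Qed.

Lemma finite_covers_down (C : updownCategory) (p : C) :
  finite_set [set q : C | covers q p].
Proof.
by apply: sub_finite_set (rank_finite C (rank p).-1) => q /= /coversP[->].
Qed.

Definition evenly_up_covered (C : updownCategory) (u : nat -> rat) : Prop :=
  forall (n : nat) (p : C), rank p = n ->
    \sum_(q \in [set q : C | covers p q]) umult p q = u n.

(* The value d 0 is irrelevant. *)
Definition evenly_down_covered (C : updownCategory) (d : nat -> rat) : Prop :=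
  forall (n : nat) (p : C), (1 <= n)%N -> rank p = n ->
    \sum_(q \in [set q : C | covers q p]) dmult q p = d n.

(* An element of Q[[t]] is given by its sequence of coefficients. *)
Definition fps : Type := nat -> rat.

(* The formal sum of c i * t ^ (e i) over i in D.  It is meaningful when only
   finitely many i in D have a given exponent. *)
Definition fps_sum (I : choiceType) (D : set I) (c : I -> rat) (e : I -> nat) :
    fps :=
  fun k => \sum_(i \in [set i : I | D i /\ e i = k]) c i.

Definition objGF (C : updownCategory) : fps :=
  fps_sum [set: C] (fun p => (#|aut p|%:R)^-1) (fun p => rank p).

Definition morGF (C : updownCategory) : fps :=
  fps_sum [set pq : C * C | covers pq.1 pq.2]
    (fun pq => umult pq.1 pq.2 / #|aut pq.1|%:R)
    (fun pq => (rank pq.1 + rank pq.2)%N).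

(* The formal sums objGF and morGF are meaningful. *)
Lemma objGF_finite (C : updownCategory) (k : nat) :
  finite_set [set p : C | [set: C] p /\ rank p = k].
Proof. by apply: sub_finite_set (rank_finite C k) => p []. Qed.

Lemma morGF_finite (C : updownCategory) (k : nat) :
  finite_set [set pq : C * C |
    covers pq.1 pq.2 /\ (rank pq.1 + rank pq.2)%N = k].
Proof.
apply: sub_finite_set
  (finite_setX (rank_finite C k./2) (rank_finite C k./2.+1)).
case=> p q /= [/coversP[-> _] <-].
by rewrite addnS addnn /= uphalf_double.
Qed.

(* Main.v *)
(* Since |q| = |p| + 1 when q covers p, only odd exponents 2n + 1 occur in the
   morphism generating function, and the coefficient of t^(2n+1) is the sum of
   |Hom(p, q)| / (|Aut p| |Aut q|) over the covering pairs with p of rank n and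
   q of rank n + 1.  Summing over q first turns this into
   sum_p (sum_q u(p; q)) / |Aut p| = u_n a_n; summing over p first turns it into
   sum_q (sum_p d(p; q)) / |Aut q| = d_(n+1) a_(n+1). *)
Require Import Defs.
From mathcomp Require Import all_boot all_order all_algebra.
From mathcomp Require Import boolp classical_sets functions cardinality fsbigop.
Set Implicit Arguments. Unset Strict Implicit. Unset Printing Implicit Defensive.
Local Open Scope classical_set_scope.
Local Open Scope ring_scope.

(** Moving [E] into the summand, with [idx] as default value, leaves a sum over a finite rectangle,
    which can be iterated. *)
Lemma fsbig_pair_dep (R : Type) (idx : R) (op : Monoid.com_law idx)
    (I J : choiceType) (A : set I) (B : set J) (E : I -> J -> Prop)
    (F : I -> J -> R) :
  finite_set A -> finite_set B ->
  \big[op/idx]_(x \in (A `*` B) `&` [set x | E x.1 x.2]) F x.1 x.2 =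
  \big[op/idx]_(i \in A) \big[op/idx]_(j \in B `&` [set j | E i j]) F i j.
Proof.
move=> finA finB; under [RHS]eq_fsbigr do rewrite fsbig_mkcondr.
by rewrite fsbig_mkcondr pair_fsbig.
Qed.

Lemma fps_sum_coef (I : choiceType) (D : set I) (c : I -> rat) (e : I -> nat)
    (i : I) :
  D i -> (forall j, D j -> e j = e i -> j = i) -> fps_sum D c e (e i) = c i.
Proof.
move=> Di e_inj; rewrite -[RHS](fsbig_set1 +%R i c).
apply: eq_fsbigl; apply/seteqP; split=> j /=; first by case; apply: e_inj.
by move=> ->.
Qed.

Lemma fps_sum_coef0 (I : choiceType) (D : set I) (c : I -> rat) (e : I -> nat)
    (k : nat) :
  (forall i, D i -> e i <> k) -> fps_sum D c e k = 0.
Proof.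
move=> ek; rewrite /fps_sum (_ : [set i | _] = set0) ?fsbig_set0 //.
by apply/seteqP; split=> // i [/ek].
Qed.

Definition level (C : updownCategory) (n : nat) : set C := [set p | rank p = n].
Arguments level : clear implicits.

Lemma objGF_coef (C : updownCategory) (n : nat) :
  objGF C n = \sum_(p \in level C n) (#|aut p|%:R : rat)^-1.
Proof.
by apply: eq_fsbigl; apply/seteqP; split=> p // [].
Qed.

Lemma morGF_coef_even (C : updownCategory) (k : nat) :
  ~~ odd k -> morGF C k = 0.
Proof.
move=> ek; apply: fps_sum_coef0 => -[p q] /coversP[/= -> _] kE.
by move: ek; rewrite -kE addnS addnn /= odd_double.
Qed.

(** A covering pair has exponent [2 * rank p + 1], which determines both ranks. The rectangle of two
    finite levels allows summation in either order. *)
Lemma morGF_coef_odd (C : updownCategory) (n : nat) :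
  morGF C n.*2.+1 =
  \sum_(x \in (level C n `*` level C n.+1) `&` [set x | covers x.1 x.2])
    umult x.1 x.2 / #|aut x.1|%:R.
Proof.
apply: eq_fsbigl; apply/seteqP; split=> -[p q] /=; last first.
  by move=> [[-> ->] pq]; rewrite addnS addnn.
move=> [pq +]; have [rq _] := (coversP p q).1 pq.
by rewrite /level /= rq addnS addnn => -[/double_inj <-].
Qed.

(** Brings the inner sum to the index set used in [evenly_up_covered]. *)
Lemma level_covers_up (C : updownCategory) (n : nat) (p : C) :
  rank p = n ->
  level C n.+1 `&` [set q | covers p q] = [set q | covers p q].
Proof.
by move=> <-; apply/seteqP; split=> [q []|q pq] //; split=> //; have /coversP[] := pq.
Qed.

Lemma level_covers_down (C : updownCategory) (n : nat) (q : C) :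
  rank q = n.+1 ->
  level C n `&` [set p | covers p q] = [set p | covers p q].
Proof.
move=> rq; apply/seteqP; split=> [p []|p pq] //; split=> //.
by have /coversP[] := pq; rewrite rq => -[].
Qed.

Lemma morGF_coef_up (C : updownCategory) (u : nat -> rat) (n : nat) :
  evenly_up_covered C u -> morGF C n.*2.+1 = objGF C n * u n.
Proof.
move=> Cu; rewrite morGF_coef_odd objGF_coef.
rewrite (fsbig_pair_dep _ (fun p q => covers p q)
  (fun p q => umult p q / #|aut p|%:R)); try exact: rank_finite.
rewrite mulr_fsuml; apply: eq_fsbigr => p /set_mem rp.
by rewrite level_covers_up // -mulr_fsuml (Cu n) // GRing.mulrC.
Qed.

Lemma morGF_coef_down (C : updownCategory) (d : nat -> rat) (n : nat) :
  evenly_down_covered C d -> morGF C n.*2.+1 = objGF C n.+1 * d n.+1.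
Proof.
move=> Cd; rewrite morGF_coef_odd objGF_coef.
rewrite (fsbig_pair_dep _ (fun p q => covers p q)
  (fun p q => umult p q / #|aut p|%:R)); try exact: rank_finite.
(* The inner index set depends on [p]; the covering condition goes into the summand so that both
   sums range over fixed levels and can be exchanged. *)
under eq_fsbigr do rewrite fsbig_mkcondr.
rewrite exchange_fsbig; try exact: rank_finite.
rewrite mulr_fsuml; apply: eq_fsbigr => q /set_mem rq.
(* The condition is reread as one on [p] with [q] fixed, then turned back into an index set. *)
under eq_fsbigr => p _.
  rewrite (_ : (q \in _) = (p \in [set p | covers p q])); last first.
    by apply/idP/idP => /set_mem pq; apply/mem_set.
  over.
rewrite -fsbig_mkcondr level_covers_down // -(Cd n.+1 q) // mulr_fsumr.
(* Both terms equal |Hom(p, q)| / (|Aut p| |Aut q|). *)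
by apply: eq_fsbigr => p _; rewrite /umult /dmult GRing.mulrAC GRing.mulrC.
Qed.

Theorem theorem3p4 (C : updownCategory) (a : nat -> rat)
  (ha : objGF C = fps_sum [set: nat] a (fun n => n)) :
  (forall u : nat -> rat, evenly_up_covered C u ->
     morGF C =
       fps_sum [set: nat] (fun n => a n * u n) (fun n => (2 * n + 1)%N)) /\
  (forall d : nat -> rat, evenly_down_covered C d ->
     morGF C =
       fps_sum [set n : nat | (1 <= n)%N] (fun n => a n * d n)
         (fun n => (2 * n - 1)%N)).
Proof.
have aE n : objGF C n = a n by rewrite ha fps_sum_coef.
split=> [u Cu|d Cd]; apply/funext => k; case: (boolP (odd k)) => [ok|ek].
- have -> : k = (2 * k./2 + 1)%N by rewrite mul2n addnC -[LHS]odd_double_half ok.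
  rewrite (fps_sum_coef _ (e := fun n => (2 * n + 1)%N)) //; last first.
    by move=> n _; rewrite !addn1 !mul2n => -[/double_inj].
  by rewrite addn1 mul2n (morGF_coef_up _ Cu) aE.
- rewrite morGF_coef_even // fps_sum_coef0 // => n _ kE.
  by move: ek; rewrite -kE addn1 mul2n /= odd_double.
(* The index is the rank of the upper object, one more than [k./2]. *)
- have -> : k = (2 * k./2.+1 - 1)%N.
    by rewrite mul2n doubleS subn1 /= -[LHS]odd_double_half ok.
  rewrite (fps_sum_coef _ (e := fun n => (2 * n - 1)%N)) //; last first.
    move=> [//|n] _; rewrite !subn1 !mul2n !doubleS /=.
    by move=> -[/double_inj ->].
  by rewrite mul2n doubleS subn1 /= (morGF_coef_down _ Cd) aE.
(* Truncated subtraction would give index 0 the even exponent 0; the bound [1 <= n] rules it out. *)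
- rewrite morGF_coef_even // fps_sum_coef0 // => -[//|n] _ kE.
  by move: ek; rewrite -kE mul2n doubleS subn1 /= odd_double.
Qed.
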